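(* Let $n\ge3$. The hypoplactic congruence $\ddot{\sim}$ on the free monoid $C_n^*$ is not finitely generated (as a monoid congruence). Therefore $\mathrm{hypo}(\mathcal{C}_n)$ has no finite presentation.
   Context: Let $C_n=\{1<2<\cdots<n<\bar n<\overline{n-1}<\cdots<\bar 1\}$; $C_n^*$ is the free monoid of words over $C_n$ and $|w|_a$ the number of occurrences of the letter $a$ in $w$. Convention: the symbols $n+1$ and $\overline{n+1}$ never occur in any word. For $i\in\{1,\dots,n\}$, $w$ has an $i$-inversion if $w=w_1xw_2yw_3$ with $x\in\{i,\overline{i+1}\}$, $y\in\{i+1,\bar i\}$. Quasi-crystal structure on $C_n^*$: $\mathrm{wt}(w)=(|w|_1-|w|_{\bar1},\dots,|w|_n-|w|_{\bar n})\in\mathbb{Z}^n$. For $i\in\{1,\dots,n\}$: if $w$ has an $i$-inversion then $\ddot{\varepsilon}_i(w)=\ddot{\varphi}_i(w)=+\infty$ and $\ddot{e}_i(w),\ddot{f}_i(w)$ are undefined; otherwise $\ddot{\varepsilon}_i(w)=|w|_{i+1}+|w|_{\bar i}$, $\ddot{\varphi}_i(w)=|w|_i+|w|_{\overline{i+1}}$; $\ddot{e}_i(w)$ is defined iff $\ddot{\varepsilon}_i(w)>0$ and is obtained by replacing the right-most letter of $w$ lying in $\{i+1,\bar i\}$ by its image ($i+1\mapsto i$, $\bar i\mapsto\overline{i+1}$ for $i<n$; $\bar n\mapsto n$ for $i=n$); $\ddot{f}_i(w)$ is defined iff $\ddot{\varphi}_i(w)>0$ and is obtained by replacing the left-most letter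 of $w$ lying in $\{i,\overline{i+1}\}$ by its image ($i\mapsto i+1$, $\overline{i+1}\mapsto\bar i$ for $i<n$; $n\mapsto\bar n$ for $i=n$). The connected component $C_n^*(w)$ is the set of words obtained from $w$ by finitely many (defined) applications of the operators $\ddot{e}_i,\ddot{f}_i$. Hypoplactic congruence: $u\ddot{\sim}v$ iff there is a bijection $\psi:C_n^*(u)\to C_n^*(v)$ with $\psi(u)=v$ such that for all $x\in C_n^*(u)$ and $i$: $\psi(x)$ has the same $\mathrm{wt},\ddot{\varepsilon}_i,\ddot{\varphi}_i$ as $x$, $\ddot{e}_i(\psi(x))$ is defined iff $\ddot{e}_i(x)$ is (and then $\psi(\ddot{e}_i(x))=\ddot{e}_i(\psi(x))$), and likewise for $\ddot{f}_i$. It is a monoid congruence on $C_n^*$ and $\mathrm{hypo}(\mathcal{C}_n)=C_n^*/\ddot{\sim}$. *)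

(* Defs.v *)
From HB Require Import structures.
From mathcomp Require Import all_boot ssralg ssrint.
From mathcomp Require Import boolp classical_sets functions.

Set Implicit Arguments.
Unset Strict Implicit.
Unset Printing Implicit Defensive.

Import GRing.Theory.
Local Open Scope quotient_scope.

Definition free_monoid (A : choiceType) : Type := seq A.

HB.instance Definition _ (A : choiceType) := Choice.on (free_monoid A).
HB.instance Definition _ (A : choiceType) :=
  isMonoid.Build (free_monoid A) (@catA A) (@cat0s A) (@cats0 A).

Record congruence (M : monoidType) := Congruence {
  cong_rel :> M -> M -> Prop;
  cong_refl : forall x, cong_rel x x;
  cong_sym : forall x y, cong_rel x y -> cong_rel y x;
  cong_trans : forall y x z, cong_rel x y -> cong_rel y z -> cong_rel x z;
  cong_mul : forall x x' y y',
    cong_rel x x' -> cong_rel y y' -> cong_rel (x * y)%g (x' * y')%g }.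

Section QuotientMonoid.
Variables (M : monoidType) (c : congruence M).

Definition cong_relb : rel M := fun x y => `[< c x y >].

Lemma cong_relb_refl : reflexive cong_relb.
Proof. by move=> x; apply/asboolP; apply: cong_refl. Qed.

Lemma cong_relb_sym : symmetric cong_relb.
Proof. by move=> x y; apply/asboolP/asboolP; apply: cong_sym. Qed.

Lemma cong_relb_trans : transitive cong_relb.
Proof.
by move=> y x z /asboolP xy /asboolP yz; apply/asboolP; apply: cong_trans yz.
Qed.

Canonical cong_equiv := EquivRel cong_relb
  cong_relb_refl cong_relb_sym cong_relb_trans.

Definition quotient_monoid : Type := {eq_quot cong_equiv}.
HB.instance Definition _ := Choice.on quotient_monoid.
HB.instance Definition _ := EqQuotient.on quotient_monoid.

Definition quotient_one : quotient_monoid := \pi_quotient_monoid 1%g.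
Definition quotient_mul (x y : quotient_monoid) : quotient_monoid :=
  \pi_quotient_monoid (repr x * repr y)%g.

Lemma quotient_piP (x y : M) :
  \pi_quotient_monoid x = \pi_quotient_monoid y <-> c x y.
Proof.
by split=> [/eqmodP /asboolP //|cxy]; apply/eqmodP/asboolP.
Qed.

Lemma quotient_mulE (x y : M) :
  quotient_mul (\pi_quotient_monoid x) (\pi_quotient_monoid y)
  = \pi_quotient_monoid (x * y)%g.
Proof.
by apply/quotient_piP; apply: cong_mul; apply/quotient_piP; rewrite reprK.
Qed.

Lemma quotient_piW (P : quotient_monoid -> Prop) :
  (forall x : M, P (\pi_quotient_monoid x)) -> forall q, P q.
Proof. by move=> Ppi q; rewrite -[q]reprK; apply: Ppi. Qed.

Lemma quotient_mulA : associative quotient_mul.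
Proof.
apply: quotient_piW => x; apply: quotient_piW => y; apply: quotient_piW => z.
rewrite (quotient_mulE y z) (quotient_mulE x y) (quotient_mulE x).
by rewrite (quotient_mulE (x * y)%g) mulgA.
Qed.

Lemma quotient_mul1 : left_id quotient_one quotient_mul.
Proof. by apply: quotient_piW => x; rewrite quotient_mulE mul1g. Qed.

Lemma quotient_mulr1 : right_id quotient_one quotient_mul.
Proof. by apply: quotient_piW => x; rewrite quotient_mulE mulg1. Qed.

HB.instance Definition _ := isMonoid.Build quotient_monoid
  quotient_mulA quotient_mul1 quotient_mulr1.

End QuotientMonoid.

Section GeneratedCongruence.
Variables (M : monoidType) (R : seq (M * M)).

Inductive gen_cong_rel : M -> M -> Prop :=
| gen_cong_base x y : (x, y) \in R -> gen_cong_rel x y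
| gen_cong_refl x : gen_cong_rel x x
| gen_cong_sym x y : gen_cong_rel x y -> gen_cong_rel y x
| gen_cong_trans y x z :
    gen_cong_rel x y -> gen_cong_rel y z -> gen_cong_rel x z
| gen_cong_mul x x' y y' :
    gen_cong_rel x x' -> gen_cong_rel y y' ->
    gen_cong_rel (x * y)%g (x' * y')%g.

Definition gen_cong : congruence M :=
  Congruence gen_cong_refl gen_cong_sym gen_cong_trans gen_cong_mul.

End GeneratedCongruence.

Definition finitely_generated_congruence (M : monoidType) (c : congruence M) :=
  exists R : seq (M * M), forall x y, c x y <-> gen_cong R x y.

Definition finitely_presented (M : monoidType) :=
  exists (A : finType) (R : seq (free_monoid A * free_monoid A))
         (f : quotient_monoid (gen_cong R) -> M),
    [/\ f 1%g = 1%g, {morph f : x y / (x * y)%g} & bijective f].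

(* Indices are shifted by one: [i : 'I_n] stands for the index [i + 1] of
   [{1, ..., n}].  The pair [(i, false)] is the unbarred letter [i + 1] and
   [(i, true)] is its barred version. *)
Definition letter (n : nat) : Type := ('I_n * bool)%type.
HB.instance Definition _ n := Finite.on (letter n).

Notation word n := (free_monoid (letter n)).

Section QuasiCrystal.
Variable n : nat.
Implicit Types (i : 'I_n) (a b : letter n) (u v w x y : word n).

(* The successor of [i], or [None] for the last index. *)
Definition next_index i : option 'I_n := insub i.+1.

(* [a] lies in {i, bar(i+1)}; for the last index this set is {i}. *)
Definition plus_letter i a : bool :=
  if a.2 then Some a.1 == next_index i else a.1 == i.

(* [a] lies in {i+1, bar i}; for the last index this set is {bar i}. *)
Definition minus_letter i a : bool :=
  if a.2 then a.1 == i else Some a.1 == next_index i.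

(* i+1 |-> i and bar i |-> bar(i+1), except that bar n |-> n. *)
Definition e_letter i a : letter n :=
  if a.2 then (if next_index i is Some j then (j, true) else (i, false))
  else (i, false).

(* i |-> i+1 and bar(i+1) |-> bar i, except that n |-> bar n. *)
Definition f_letter i a : letter n :=
  if a.2 then (i, true)
  else if next_index i is Some j then (j, false) else (i, true).

Fixpoint replace_first (T : Type) (p : pred T) (g : T -> T) (s : seq T) :=
  if s is x :: s' then
    if p x then g x :: s' else x :: replace_first p g s'
  else [::].

Definition replace_last (T : Type) (p : pred T) (g : T -> T) (s : seq T) :=
  rev (replace_first p g (rev s)).

Definition inversion i w : Prop :=
  exists (w1 : word n) a (w2 : word n) b (w3 : word n),
    [/\ w = w1 ++ a :: w2 ++ b :: w3, plus_letter i a & minus_letter i b].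

Definition wt w : {ffun 'I_n -> int} :=
  [ffun i => ((count_mem (i, false) w)%:Z - (count_mem (i, true) w)%:Z)%R].

(* [None] stands for the value +oo. *)
Definition qeps i w : option nat :=
  if `[< inversion i w >] then None else Some (count (minus_letter i) w).

Definition qphi i w : option nat :=
  if `[< inversion i w >] then None else Some (count (plus_letter i) w).

(* Here, in contrast, [None] means undefined. *)
Definition qe i w : option (word n) :=
  if qeps i w is Some _.+1
  then Some (replace_last (minus_letter i) (e_letter i) w) else None.

Definition qf i w : option (word n) :=
  if qphi i w is Some _.+1
  then Some (replace_first (plus_letter i) (f_letter i) w) else None.

Inductive component w : word n -> Prop :=
| component_refl : component w w
| component_e i x y : component w x -> qe i x = Some y -> component w y
| component_f i x y : component w x -> qf i x = Some y -> component w y.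

Definition component_iso u v (psi : word n -> word n) : Prop :=
  [/\ set_bij (component u) (component v) psi,
      psi u = v
    & forall x, component u x ->
        wt (psi x) = wt x /\
        forall i, [/\ qeps i (psi x) = qeps i x,
                      qphi i (psi x) = qphi i x,
                      qe i (psi x) = omap psi (qe i x)
                    & qf i (psi x) = omap psi (qf i x)]].

Definition hypoplactic u v : Prop := exists psi, component_iso u v psi.

Lemma inversionP i w :
  inversion i w <->
  ~~ pairwise (fun a b => ~~ (plus_letter i a && minus_letter i b)) w.
Proof.
split=> [[w1 [x [w2 [y [w3 [-> px my]]]]]]|].
  by rewrite pairwise_cat /= all_cat /= px my !(andbF, andFb).
elim: w => //= a w IHw; rewrite negb_and => /orP[|/IHw]; last first.
  move=> [w1 [x [w2 [y [w3 [-> px my]]]]]].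
  by exists (a :: w1), x, w2, y, w3.
rewrite -has_predC => /hasP[b bw]; rewrite /= negbK => /andP[pa mb].
case/splitPr: bw => w2 w3; by exists [::], a, w2, b, w3.
Qed.

Lemma inversion_cat i u v :
  inversion i (u ++ v) <->
  [\/ inversion i u, inversion i v
    | has (plus_letter i) u /\ has (minus_letter i) v].
Proof.
have hE : ~~ allrel (fun a b => ~~ (plus_letter i a && minus_letter i b)) u v
    <-> has (plus_letter i) u /\ has (minus_letter i) v.
  split=> [|[/hasP[x xu px] /hasP[y yv my]]].
    rewrite /allrel -has_predC => /hasP[x xu /=].
    rewrite -has_predC => /hasP[y yv /=]; rewrite negbK => /andP[px my].
    by split; apply/hasP; [exists x|exists y].
  apply/negP => /allrelP /(_ x y xu yv); by rewrite px my.
rewrite inversionP pairwise_cat !negb_and; split=> [/or3P[]|].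
- by move/hE=> ?; apply: Or33.
- by move/inversionP=> ?; apply: Or31.
- by move/inversionP=> ?; apply: Or32.
by case=> [/inversionP ->|/inversionP ->|/hE ->]; rewrite ?orbT.
Qed.

Definition cat_value (eu pu ev pv : option nat) : option nat :=
  match eu, pu, ev, pv with
  | Some a, Some b, Some c, Some d =>
      if (0 < b) && (0 < c) then None else Some (a + c)
  | _, _, _, _ => None
  end.

Lemma qeps_cat i u v :
  qeps i (u ++ v) = cat_value (qeps i u) (qphi i u) (qeps i v) (qphi i v).
Proof.
rewrite /qeps /qphi /cat_value; case: asboolP => [/inversion_cat|].
  case=> [iu|iv|[pu mv]].
  - by rewrite asboolT.
  - by case: asbool => //; rewrite asboolT.
  - by case: asbool => //; case: asbool => //; rewrite -!has_count pu mv.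
move=> ni; rewrite !asboolF.
- rewrite -!has_count count_cat; case: ifP => // /andP[pu mv].
  by case: ni; apply/inversion_cat; apply: Or33.
- by move=> iv; apply/ni/inversion_cat; apply: Or32.
- by move=> iu; apply/ni/inversion_cat; apply: Or31.
Qed.

Lemma qphi_cat i u v :
  qphi i (u ++ v) = cat_value (qphi i v) (qeps i v) (qphi i u) (qeps i u).
Proof.
rewrite /qeps /qphi /cat_value; case: asboolP => [/inversion_cat|].
  case=> [iu|iv|[pu mv]].
  - by case: asbool => //; rewrite asboolT.
  - by rewrite asboolT.
  - by case: asbool => //; case: asbool => //; rewrite -!has_count pu mv.
move=> ni; rewrite !asboolF.
- rewrite -!has_count count_cat addnC; case: ifP => // /andP[mv pu].
  by case: ni; apply/inversion_cat; apply: Or33.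
- by move=> iu; apply/ni/inversion_cat; apply: Or31.
- by move=> iv; apply/ni/inversion_cat; apply: Or32.
Qed.

Lemma replace_first_cat T (p : pred T) g (s t : seq T) :
  replace_first p g (s ++ t) =
  if has p s then replace_first p g s ++ t else s ++ replace_first p g t.
Proof. by elim: s => //= x s ->; case: (p x) => //=; case: (has p s). Qed.

Lemma replace_last_cat T (p : pred T) g (s t : seq T) :
  replace_last p g (s ++ t) =
  if has p t then s ++ replace_last p g t else replace_last p g s ++ t.
Proof.
rewrite /replace_last rev_cat replace_first_cat has_rev.
by case: ifP; rewrite rev_cat revK.
Qed.

Lemma size_replace_first T (p : pred T) g (s : seq T) :
  size (replace_first p g s) = size s.
Proof. by elim: s => //= x s IHs; case: ifP => //= _; rewrite IHs. Qed.

Lemma qe_cat i u v :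
  qe i (u ++ v) =
  if qeps i (u ++ v) is None then None
  else if qeps i v is Some _.+1 then omap (cat u) (qe i v)
  else omap (cat^~ v) (qe i u).
Proof.
rewrite /qe qeps_cat /cat_value /qeps /qphi.
case: asboolP => //= nu; case: asboolP => //= nv.
rewrite -!has_count; case: ifP => // _; rewrite replace_last_cat has_count.
case: (count _ v) => [|k] /=; first by rewrite addn0; case: (count _ u).
by rewrite addnS.
Qed.

Lemma qf_cat i u v :
  qf i (u ++ v) =
  if qphi i (u ++ v) is None then None
  else if qphi i u is Some _.+1 then omap (cat^~ v) (qf i u)
  else omap (cat u) (qf i v).
Proof.
rewrite /qf qphi_cat /cat_value /qeps /qphi.
case: asboolP => //= nv; case: asboolP => //= nu.
rewrite -!has_count; case: ifP => // _; rewrite replace_first_cat has_count.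
case: (count _ u) => [|k] /=; first by rewrite addn0; case: (count _ v).
by rewrite addnS.
Qed.

Lemma wt_cat u v : wt (u ++ v) = [ffun i => (wt u i + wt v i)%R].
Proof.
by apply/ffunP => i; rewrite !ffunE !count_cat !PoszD opprD addrACA.
Qed.

Lemma size_qe i x y : qe i x = Some y -> size y = size x.
Proof.
rewrite /qe; case: qeps => // -[//|k] [<-].
by rewrite /replace_last size_rev size_replace_first size_rev.
Qed.

Lemma size_qf i x y : qf i x = Some y -> size y = size x.
Proof.
by rewrite /qf; case: qphi => // -[//|k] [<-]; rewrite size_replace_first.
Qed.

(* A one-to-one bisimulation restricts to a component isomorphism. *)
Definition option_rel (B : word n -> word n -> Prop) (x y : option (word n)) :=
  match x, y with
  | Some x', Some y' => B x' y'
  | None, None => True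
  | _, _ => False
  end.

Record bisimulation (B : word n -> word n -> Prop) : Prop := Bisimulation {
  bisim_injl : forall x x' y, B x y -> B x' y -> x = x';
  bisim_injr : forall x y y', B x y -> B x y' -> y = y';
  bisim_wt : forall x y, B x y -> wt x = wt y;
  bisim_eps : forall i x y, B x y -> qeps i x = qeps i y;
  bisim_phi : forall i x y, B x y -> qphi i x = qphi i y;
  bisim_e : forall i x y, B x y -> option_rel B (qe i x) (qe i y);
  bisim_f : forall i x y, B x y -> option_rel B (qf i x) (qf i y) }.

Lemma option_rel_sym B (x y : option (word n)) :
  option_rel B x y -> option_rel (fun y x => B x y) y x.
Proof. by case: x y => [x|] [y|]. Qed.

Lemma bisimulation_sym B :
  bisimulation B -> bisimulation (fun x y => B y x).
Proof.
case=> il ir bw be bp bE bF; split.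
- by move=> x x' y /ir; apply.
- by move=> x y y' /il; apply.
- by move=> x y /bw.
- by move=> i x y /be.
- by move=> i x y /bp.
- by move=> i x y /bE/option_rel_sym; apply.
- by move=> i x y /bF/option_rel_sym; apply.
Qed.

Lemma bisimulation_component B u v x : bisimulation B -> B u v ->
  component u x -> exists2 y, component v y & B x y.
Proof.
move=> bB uv; elim=> [|i {}x x' _ [y vy xy] e|i {}x x' _ [y vy xy] e].
- by exists v => //; apply: component_refl.
- have := bisim_e bB i xy; rewrite e; case e': (qe i y) => [y'|] //= xy'.
  by exists y' => //; apply: component_e e'.
- have := bisim_f bB i xy; rewrite e; case e': (qf i y) => [y'|] //= xy'.
  by exists y' => //; apply: component_f e'.
Qed.

Lemma hypoplacticP u v :
  hypoplactic u v <-> exists2 B, bisimulation B & B u v.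
Proof.
split=> [[psi [[_ inj _] <- H]]|[B bB uv]].
  exists (fun x y => component u x /\ y = psi x); last first.
    by split=> //; apply: component_refl.
  split.
  - move=> x x' y [ux ->] [ux' /esym eq]; symmetry.
    by apply: inj eq; rewrite inE.
  - by move=> x y y' [_ ->] [_ ->].
  - by move=> x y [ux ->]; have [-> _] := H x ux.
  - by move=> i x y [ux ->]; have [_ /(_ i)[-> _ _ _]] := H x ux.
  - by move=> i x y [ux ->]; have [_ /(_ i)[_ -> _ _]] := H x ux.
  - move=> i x y [ux ->]; have [_ /(_ i)[_ _ -> _]] := H x ux.
    by case e: qe => [x'|] //=; split=> //; apply: component_e e.
  - move=> i x y [ux ->]; have [_ /(_ i)[_ _ _ ->]] := H x ux.
    by case e: qf => [x'|] //=; split=> //; apply: component_f e.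
have [psi psiP] : exists psi, forall x, component u x -> B x (psi x).
  have /choice : forall x, exists y, component u x -> B x y.
    move=> x; have [ux|nux] := pselect (component u x).
      by have [y _ xy] := bisimulation_component bB uv ux; exists y.
    by exists x.
  by case=> psi H; exists psi.
exists psi; have psiE x y : component u x -> B x y -> psi x = y.
  by move=> /psiP; apply: bisim_injr.
split.
- split.
  + move=> x ux; have [y vy xy] := bisimulation_component bB uv ux.
    by rewrite (psiE x y).
  + move=> x x'; rewrite !inE => /psiP h /psiP h' e; rewrite -e in h'.
    exact: bisim_injl h h'.
  + move=> y vy.
    have [x ux xy] := bisimulation_component (bisimulation_sym bB) uv vy.
    by exists x => //; apply: psiE.
- by apply: psiE => //; apply: component_refl.
move=> x ux; have xy := psiP x ux.
split; first by rewrite (bisim_wt bB xy).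
move=> i; split.
- by rewrite (bisim_eps bB i xy).
- by rewrite (bisim_phi bB i xy).
- have := bisim_e bB i xy; case e: (qe i x) => [x'|]; case: qe => //= y xy'.
  by rewrite (psiE x' y) //; apply: component_e e.
- have := bisim_f bB i xy; case e: (qf i x) => [x'|]; case: qf => //= y xy'.
  by rewrite (psiE x' y) //; apply: component_f e.
Qed.

Lemma hypoplactic_refl u : hypoplactic u u.
Proof.
apply/hypoplacticP; exists eq => //; split=> //.
- by move=> x x' y -> ->.
- by move=> x y y' -> ->.
- by move=> x y ->.
- by move=> i x y ->.
- by move=> i x y ->.
- by move=> i x y ->; case: qe.
- by move=> i x y ->; case: qf.
Qed.

Lemma hypoplactic_sym u v : hypoplactic u v -> hypoplactic v u.
Proof.
move=> /hypoplacticP[B bB uv]; apply/hypoplacticP.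
by exists (fun x y => B y x) => //; apply: bisimulation_sym.
Qed.

Lemma hypoplactic_trans v u w :
  hypoplactic u v -> hypoplactic v w -> hypoplactic u w.
Proof.
move=> /hypoplacticP[B bB uv] /hypoplacticP[C bC vw]; apply/hypoplacticP.
exists (fun x z => exists2 y, B x y & C y z); last by exists v.
split.
- move=> x x' z [y xy yz] [y' xy' yz'].
  by rewrite -(bisim_injl bC yz yz') in xy'; exact: bisim_injl xy xy'.
- move=> x z z' [y xy yz] [y' xy' yz'].
  by rewrite -(bisim_injr bB xy xy') in yz'; exact: bisim_injr yz yz'.
- by move=> x z [y /(bisim_wt bB) -> /(bisim_wt bC)].
- by move=> i x z [y /(bisim_eps bB i) -> /(bisim_eps bC i)].
- by move=> i x z [y /(bisim_phi bB i) -> /(bisim_phi bC i)].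
- move=> i x z [y /(bisim_e bB i) + /(bisim_e bC i)].
  by case: (qe i x) (qe i y) (qe i z) => [x'|] [y'|] [z'|] //=; exists y'.
- move=> i x z [y /(bisim_f bB i) + /(bisim_f bC i)].
  by case: (qf i x) (qf i y) (qf i z) => [x'|] [y'|] [z'|] //=; exists y'.
Qed.

Lemma hypoplactic_mul u u' v v' : hypoplactic u u' -> hypoplactic v v' ->
  hypoplactic (u * v)%g (u' * v')%g.
Proof.
move=> /hypoplacticP[B bB uu'] /hypoplacticP[C bC vv']; apply/hypoplacticP.
pose D x y := exists x1 x2 y1 y2,
  [/\ x = x1 ++ x2, y = y1 ++ y2, B x1 y1, C x2 y2
    & size x1 = size u /\ size y1 = size u'].
exists D; last by exists u, v, u', v'.
have eps_eq i x1 x2 y1 y2 : B x1 y1 -> C x2 y2 ->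
    qeps i (x1 ++ x2) = qeps i (y1 ++ y2).
  move=> b c; rewrite !qeps_cat (bisim_eps bB i b) (bisim_phi bB i b).
  by rewrite (bisim_eps bC i c) (bisim_phi bC i c).
have phi_eq i x1 x2 y1 y2 : B x1 y1 -> C x2 y2 ->
    qphi i (x1 ++ x2) = qphi i (y1 ++ y2).
  move=> b c; rewrite !qphi_cat (bisim_eps bB i b) (bisim_phi bB i b).
  by rewrite (bisim_eps bC i c) (bisim_phi bC i c).
split.
- move=> x x' y [x1 [x2 [y1 [y2 [-> -> b c [sx sy]]]]]].
  move=> [x1' [x2' [y1' [y2' [-> /eqP eq b' c' [sx' sy']]]]]].
  move: eq; rewrite eqseq_cat ?sy // => /andP[/eqP e1 /eqP e2].
  rewrite -{}e1 -{}e2 in b' c'.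
  by rewrite (bisim_injl bB b b') (bisim_injl bC c c').
- move=> x y y' [x1 [x2 [y1 [y2 [-> -> b c [sx sy]]]]]].
  move=> [x1' [x2' [y1' [y2' [/eqP eq -> b' c' [sx' sy']]]]]].
  move: eq; rewrite eqseq_cat ?sx // => /andP[/eqP e1 /eqP e2].
  rewrite -{}e1 -{}e2 in b' c'.
  by rewrite (bisim_injr bB b b') (bisim_injr bC c c').
- move=> x y [x1 [x2 [y1 [y2 [-> -> b c _]]]]].
  by rewrite !wt_cat (bisim_wt bB b) (bisim_wt bC c).
- by move=> i x y [x1 [x2 [y1 [y2 [-> -> b c _]]]]]; apply: eps_eq.
- by move=> i x y [x1 [x2 [y1 [y2 [-> -> b c _]]]]]; apply: phi_eq.
- move=> i x y [x1 [x2 [y1 [y2 [-> -> b c [sx sy]]]]]].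
  rewrite !qe_cat (eps_eq i _ _ _ _ b c) (bisim_eps bC i c).
  have left_case : option_rel D (omap (cat^~ x2) (qe i x1))
      (omap (cat^~ y2) (qe i y1)).
    have := bisim_e bB i b.
    case ex: (qe i x1) => [x1'|]; case ey: (qe i y1) => [y1'|] //= b'.
    exists x1', x2, y1', y2; split=> //.
    by rewrite (size_qe ex) (size_qe ey).
  have right_case : option_rel D (omap (cat x1) (qe i x2))
      (omap (cat y1) (qe i y2)).
    have := bisim_e bC i c; case: (qe i x2) => [x2'|]; case: qe => //= y2' c'.
    by exists x1, x2', y1, y2'.
  by case: qeps => // _; case: qeps => [[|k]|].
- move=> i x y [x1 [x2 [y1 [y2 [-> -> b c [sx sy]]]]]].
  rewrite !qf_cat (phi_eq i _ _ _ _ b c) (bisim_phi bB i b).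
  have left_case : option_rel D (omap (cat^~ x2) (qf i x1))
      (omap (cat^~ y2) (qf i y1)).
    have := bisim_f bB i b.
    case ex: (qf i x1) => [x1'|]; case ey: (qf i y1) => [y1'|] //= b'.
    exists x1', x2, y1', y2; split=> //.
    by rewrite (size_qf ex) (size_qf ey).
  have right_case : option_rel D (omap (cat x1) (qf i x2))
      (omap (cat y1) (qf i y2)).
    have := bisim_f bC i c; case: (qf i x2) => [x2'|]; case: qf => //= y2' c'.
    by exists x1, x2', y1, y2'.
  by case: qphi => // _; case: qphi => [[|k]|].
Qed.

Definition hypoplactic_congruence : congruence (word n) :=
  Congruence hypoplactic_refl hypoplactic_sym hypoplactic_trans
    hypoplactic_mul.

End QuasiCrystal.

Definition hypo (n : nat) : monoidType :=
  quotient_monoid (hypoplactic_congruence n).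

(* Main.v *)
Require Import Defs.
From mathcomp Require Import all_boot.
From mathcomp Require Import ssralg ssrint boolp.

(* Write i' for the barred letter i.  The word u = 2 (2')^k 2 has a 1-inversion
   and a 2-inversion and contains no letter relevant to the operators of index
   at least 3.  Hence every operator is undefined on u, and u is congruent to
   2' 2 (2')^(k-1) 2, for which the same holds.  On the other hand 2 (2')^k and
   (2')^k 2 are congruent to no other word: an operator connects them to
   1 (2')^k and (2')^k 3, words without inversions whose letters are determined
   by the values of epsilon, phi and wt, and a wrong order of the letters is
   detected by the inversions appearing after one further operator.  So no
   congruent pair of words of length at most k rewrites u, whence the congruence
   is not finitely generated.  Finite presentability does not depend on the
   finite generating set, so it would make the congruence finitely generated. *)

Set Implicit Arguments.
Unset Strict Implicit.
Unset Printing Implicit Defensive.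

Local Open Scope quotient_scope.

(** * Isolated words and an obstruction to finite generation *)

Definition isolated (M : monoidType) (c : congruence M) (x : M) :=
  forall y, c x y -> x = y.

Lemma gen_cong_sub (M : monoidType) (R : seq (M * M)) (c : congruence M) :
  (forall x y, (x, y) \in R -> c x y) -> forall x y, gen_cong R x y -> c x y.
Proof.
move=> Rc x y; elim=> {x y} [x y /Rc//|x|x y _|y x z _ cxy _ cyz|x x' y y' _ ? _ ?].
- exact: cong_refl.
- exact: cong_sym.
- exact: cong_trans cxy cyz.
- exact: cong_mul.
Qed.

Section FreeMonoid.
Variables (A : choiceType) (c : congruence (free_monoid A)).
Implicit Types u v w x y p q : free_monoid A.

(** Replacing [x] by a congruent [y] inside the long word changes nothing; comparing lengths and
    cancelling in the free monoid gives [x = y]. *)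
Lemma isolated_factor p x q : isolated c (p ++ x ++ q) -> isolated c x.
Proof.
move=> iso y cxy.
have /iso : c (p ++ x ++ q) (p ++ y ++ q).
  apply: (cong_mul (c := c)); first exact: cong_refl.
  by apply: (cong_mul (c := c)) => //; exact: cong_refl.
move=> e; have sxy : size x = size y.
  by apply/eqP; have := congr1 size e; rewrite !size_cat => /addnI/addIn/eqP.
by move/eqP: e; rewrite eqseq_cat // eqxx /= eqseq_cat // => /andP[/eqP].
Qed.

(** The word [u] itself may fail to be isolated. The property passes to both factors of a product,
    as induction on the generated congruence requires. *)
Definition locally_isolated N u :=
  forall p x q, u = p ++ x ++ q -> size x <= N -> isolated c x.

Lemma locally_isolated_catl N u v :
  locally_isolated N (u ++ v) -> locally_isolated N u.
Proof. by move=> h p x q e; apply: (h p x (q ++ v)); rewrite e -!catA. Qed.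

Lemma locally_isolated_catr N u v :
  locally_isolated N (u ++ v) -> locally_isolated N v.
Proof. by move=> h p x q e; apply: (h (u ++ p) x q); rewrite e -!catA. Qed.

(* No defining relation of length at most [N] applies nontrivially inside [u]. *)
Lemma gen_cong_locally_isolated N (R : seq (free_monoid A * free_monoid A)) :
    (forall x y, (x, y) \in R -> [/\ c x y, size x <= N & size y <= N]) ->
  forall u v, gen_cong R u v ->
    locally_isolated N u \/ locally_isolated N v -> u = v.
Proof.
have lid u : u = [::] ++ u ++ [::] by rewrite cats0.
move=> RP u v; elim=> {u v}
  [x y /RP[cxy sx sy] [lx|ly]|//|x y _ IH|y x z _ IHl _ IHr|x x' y y' _ IHl _ IHr].
- exact: (lx _ _ _ (lid x) sx).
- by apply/esym/(ly _ _ _ (lid y) sy)/cong_sym.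
- by move=> /or_comm/IH.
- move=> [lx|lz].
  + by have exy := IHl (or_introl lx); rewrite exy in lx *; apply: IHr; left.
  + by have eyz := IHr (or_intror lz); rewrite -eyz in lz *; apply: IHl; right.
- case=> l.
    rewrite (IHl (or_introl (locally_isolated_catl l))).
    by rewrite (IHr (or_introl (locally_isolated_catr l))).
  rewrite (IHl (or_intror (locally_isolated_catl l))).
  by rewrite (IHr (or_intror (locally_isolated_catr l))).
Qed.

Lemma not_finitely_generated :
  (forall N, exists u v, [/\ c u v, u <> v & locally_isolated N u]) ->
  ~ finitely_generated_congruence c.
Proof.
move=> H [R RP].
(* A finite set of relations has a bound on the lengths of its sides. *)
pose N := \max_(r <- R) maxn (size r.1) (size r.2).
have [u [v [/RP Ruv uv lu]]] := H N.
apply: uv; apply: gen_cong_locally_isolated Ruv (or_introl lu) => x y xyR.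
have : maxn (size x) (size y) <= N.
  exact: (@leq_bigmax_seq _ R predT (fun r => maxn (size r.1) (size r.2)) (x, y)).
rewrite geq_max => /andP[? ?]; split=> //.
by apply/RP; apply: gen_cong_base.
Qed.

(** A factor of length at most [k] cannot reach across the block from [p] into [q]. If it starts
    after [p] it lies in [nseq k b ++ q]; otherwise it ends before [q] and lies in
    [p ++ nseq k b]. *)
Lemma locally_isolated_block N p k b q : N <= k ->
  isolated c (p ++ nseq k b) -> isolated c (nseq k b ++ q) ->
  locally_isolated N (p ++ nseq k b ++ q).
Proof.
move=> Nk isol isor s x t e sx.
have [sp|ps] := leqP (size p) (size s).
  have es : s = p ++ drop (size p) s.
    have := congr1 (take (size p)) e.
    by rewrite take_size_cat // (takel_cat _ sp) => ->;
      rewrite size_takel // cat_take_drop.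
  move: e; rewrite es -catA => /eqP; rewrite eqseq_cat // eqxx /= => /eqP e.
  by apply: (@isolated_factor (drop (size p) s) x t); rewrite -e.
have sz : size (s ++ x) <= size (p ++ nseq k b).
  by rewrite !size_cat size_nseq leq_add ?(ltnW ps) ?(leq_trans sx).
have := congr1 (take (size (s ++ x))) e.
rewrite !catA [in RHS]take_size_cat ?(takel_cat _ sz) // => e'.
apply: (@isolated_factor s x (drop (size (s ++ x)) (p ++ nseq k b))).
by rewrite catA -{1}e' cat_take_drop.
Qed.

End FreeMonoid.

(** * Independence of the finite generating set *)

Section ChangeOfGenerators.
Variables (B A : choiceType) (h : B -> free_monoid A).

Definition extend (u : free_monoid B) : free_monoid A := flatten (map h u).

Lemma extend_cat u v : extend (u ++ v) = extend u ++ extend v.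
Proof. by rewrite /extend map_cat flatten_cat. Qed.

Lemma gen_cong_extend (R : seq (free_monoid B * free_monoid B))
    (R' : seq (free_monoid A * free_monoid A)) :
    (forall x y, (x, y) \in R -> gen_cong R' (extend x) (extend y)) ->
  forall u v, gen_cong R u v -> gen_cong R' (extend u) (extend v).
Proof.
move=> RR' u v; elim=> {u v} [x y /RR'//|x|x y _|y x z _ ? _|x x' y y' _ ? _ ?].
- exact: gen_cong_refl.
- exact: gen_cong_sym.
- exact: gen_cong_trans.
- by rewrite !extend_cat; apply: (@gen_cong_mul _ R').
Qed.

End ChangeOfGenerators.

(** Both sides are morphisms in [u] that agree on letters, so [extend h] lifts [f] to words. *)
Lemma pi_extend (B A : choiceType) (d : congruence (free_monoid B))
    (c : congruence (free_monoid A)) (h : B -> free_monoid A)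
    (f : quotient_monoid d -> quotient_monoid c) :
    f 1%g = 1%g -> {morph f : x y / (x * y)%g} ->
    (forall b : B, \pi_(quotient_monoid c) (h b) =
       f (\pi_(quotient_monoid d) [:: b])) ->
  forall u, \pi_(quotient_monoid c) (extend h u) = f (\pi_(quotient_monoid d) u).
Proof.
move=> f1 fM hE; elim=> [|b u IHu]; first by rewrite f1.
rewrite -[b :: u]/(([:: b] : free_monoid B) * u)%g.
rewrite -(quotient_mulE d) fM -IHu -hE; apply/esym.
exact: (quotient_mulE c).
Qed.

Lemma finitely_presented_congruence (A : finType)
    (c : congruence (free_monoid A)) :
  finitely_presented (quotient_monoid c) -> finitely_generated_congruence c.
Proof.
move=> [B [R [f [f1 fM [g fK gK]]]]].
have g1 : g 1%g = 1%g by rewrite -f1 fK.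
have gM : {morph g : x y / (x * y)%g}.
  by move=> x y; rewrite -{1}[x]gK -{1}[y]gK -fM fK.
pose phi b := repr (f (\pi_(quotient_monoid (gen_cong R)) [:: b])).
pose psi a := repr (g (\pi_(quotient_monoid c) [:: a])).
have phiE := @pi_extend B A (gen_cong R) c phi f f1 fM (fun b => reprK _).
have psiE := @pi_extend A B c (gen_cong R) psi g g1 gM (fun b => reprK _).
(* Tietze transformation: the relations [R] translated to [A], and one relation per letter of [A]
   identifying it with its image under the round trip through [B]. *)
pose R' := [seq (extend phi r.1, extend phi r.2) | r <- R] ++
  [seq (([:: a] : free_monoid A), extend phi (psi a)) | a <- enum A].
have back u : gen_cong R' u (extend phi (extend psi u)).
  elim: u => [|a u IHu]; first exact: gen_cong_refl.
  rewrite -[extend psi _]/(psi a ++ extend psi u) extend_cat.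
  apply: (@gen_cong_mul _ R' [:: a] (extend phi (psi a)) u) => //.
  apply: gen_cong_base.
  by rewrite mem_cat (map_f (fun a : A => (_, _))) ?mem_enum ?orbT.
exists R' => x y; split=> [cxy|]; last first.
  apply: gen_cong_sub => {}x {}y; rewrite mem_cat => /orP[/mapP[[u v]]|/mapP[a _]].
    move=> uvR [-> ->]; apply/quotient_piP; rewrite !phiE; congr f.
    by apply/quotient_piP/gen_cong_base.
  by move=> [-> ->]; apply/quotient_piP; rewrite phiE reprK gK.
(* Both [x] and [y] are replaced by their round trips; their images over [B] are related by [R], and
   that derivation is translated to [A]. *)
apply: gen_cong_trans (back x) _; apply: gen_cong_trans (gen_cong_sym (back y)).
apply: (gen_cong_extend (R := R)) => [u v uvR|].
  apply: gen_cong_base; rewrite mem_cat; apply/orP; left.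
  exact: (map_f (fun r => (extend phi r.1, extend phi r.2)) uvR).
by apply/(@quotient_piP _ (gen_cong R)); rewrite !psiE; congr g; apply/quotient_piP.
Qed.

(** * Transport of isolation along operators, and singleton components *)

Section QuasiCrystal.
Variable n : nat.
Implicit Types (i j : 'I_n) (u v w x y z : word n).

Lemma inversion_has i w :
  inversion i w -> has (plus_letter i) w && has (minus_letter i) w.
Proof.
move=> [w1 [a [w2 [b [w3 [-> pa mb]]]]]].
by rewrite !has_cat /= !has_cat /= pa mb !orbT.
Qed.

Lemma no_inversion i w :
  ~~ (has (plus_letter i) w && has (minus_letter i) w) -> ~ inversion i w.
Proof. by move=> h /inversion_has; apply/negP. Qed.

Lemma qeps_Some i w : ~ inversion i w -> qeps i w = Some (count (minus_letter i) w).
Proof. by move=> h; rewrite /qeps asboolF. Qed.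

Lemma qphi_Some i w : ~ inversion i w -> qphi i w = Some (count (plus_letter i) w).
Proof. by move=> h; rewrite /qphi asboolF. Qed.

Lemma qe_Some i w : ~ inversion i w -> has (minus_letter i) w ->
  qe i w = Some (replace_last (minus_letter i) (e_letter i) w).
Proof. by move=> h; rewrite /qe qeps_Some // has_count; case: count. Qed.

Lemma qf_Some i w : ~ inversion i w -> has (plus_letter i) w ->
  qf i w = Some (replace_first (plus_letter i) (f_letter i) w).
Proof. by move=> h; rewrite /qf qphi_Some // has_count; case: count. Qed.

(** A bisimulation relating [x] to [y] relates [z] to the image of [y], which is [z] by isolation.
    Going back by the inverse operator relates [x] to itself, and a one-to-one relation leaves only
    [y = x]. *)
Lemma isolated_qe i x z : qe i x = Some z -> qf i z = Some x ->
  isolated (hypoplactic_congruence n) z -> isolated (hypoplactic_congruence n) x.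
Proof.
move=> xz zx iso y /hypoplacticP[B bB xy]; have := bisim_e bB i xy.
rewrite xz; case: (qe i y) => //= z' zz'.
have ez : z = z' by apply: iso; apply/hypoplacticP; exists B.
have := bisim_f bB i zz'; rewrite -ez zx /= => xx; exact: bisim_injr xx xy.
Qed.

Lemma isolated_qf i x z : qf i x = Some z -> qe i z = Some x ->
  isolated (hypoplactic_congruence n) z -> isolated (hypoplactic_congruence n) x.
Proof.
move=> xz zx iso y /hypoplacticP[B bB xy]; have := bisim_f bB i xy.
rewrite xz; case: (qf i y) => //= z' zz'.
have ez : z = z' by apply: iso; apply/hypoplacticP; exists B.
have := bisim_e bB i zz'; rewrite -ez zx /= => xx; exact: bisim_injr xx xy.
Qed.

Lemma inversion_qeps i w : qeps i w = None <-> inversion i w.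
Proof. by rewrite /qeps; case: asboolP. Qed.

Lemma counts_of_eq i x y : ~ inversion i x -> qeps i x = qeps i y ->
    qphi i x = qphi i y ->
  [/\ ~ inversion i y, count (minus_letter i) y = count (minus_letter i) x
    & count (plus_letter i) y = count (plus_letter i) x].
Proof.
move=> nx ee ep; have ny : ~ inversion i y.
  by move=> /inversion_qeps; rewrite -ee qeps_Some.
by move: ee ep; rewrite !qeps_Some ?qphi_Some // => -[->] [->].
Qed.

(** With no operator defined, the single pair [(u, v)] is already a bisimulation. *)
Lemma hypoplactic_singleton u v : wt u = wt v ->
    (forall i, [/\ qeps i u = qeps i v, qphi i u = qphi i v,
       qe i u = None /\ qe i v = None & qf i u = None /\ qf i v = None]) ->
  hypoplactic u v.
Proof.
move=> wuv H; apply/hypoplacticP; exists (fun x y => x = u /\ y = v) => //.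
split=> [x x' y [-> _] []|x y y' [_ ->] []|x y [-> ->]
  |i x y [-> ->]|i x y [-> ->]|i x y [-> ->]|i x y [-> ->]] //.
- by have [] := H i.
- by have [] := H i.
- by have [_ _ [-> ->]] := H i.
- by have [_ _ _ [-> ->]] := H i.
Qed.

End QuasiCrystal.

(** * Isolation of the two halves of the block word *)

Section Family.
Variables (n : nat) (n_ge3 : 3 <= n).

Let i1 : 'I_n := Ordinal (leq_trans (isT : 0 < 3) n_ge3).
Let i2 : 'I_n := Ordinal (leq_trans (isT : 1 < 3) n_ge3).
Let i3 : 'I_n := Ordinal n_ge3.

(** At the last index both sides are false, since no element of ['I_n] has value [n]. Membership in
    the letter classes thus becomes arithmetic without a special case. *)
Let next_index_eq (i j : 'I_n) : (Some j == next_index i) = (j == i.+1 :> nat).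
Proof.
rewrite /next_index; case: insubP => [k _ <-|]; first by rewrite (inj_eq Some_inj).
by move=> h; apply/esym; apply: contraNF h => /eqP <-.
Qed.

Let l1 : letter n := (i1, false).
Let l2 : letter n := (i2, false).
Let l3 : letter n := (i3, false).
Let b1 : letter n := (i1, true).
Let b2 : letter n := (i2, true).
Let b3 : letter n := (i3, true).

Let next1 : next_index i1 = Some i2.
Proof. by apply/esym/eqP; rewrite next_index_eq. Qed.
Let next2 : next_index i2 = Some i3.
Proof. by apply/esym/eqP; rewrite next_index_eq. Qed.

Let plusE (i : 'I_n) (a : letter n) :
  plus_letter i a = if a.2 then a.1 == i.+1 :> nat else a.1 == i :> nat.
Proof. by rewrite /plus_letter next_index_eq. Qed.
Let minusE (i : 'I_n) (a : letter n) :
  minus_letter i a = if a.2 then a.1 == i :> nat else a.1 == i.+1 :> nat.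
Proof. by rewrite /minus_letter next_index_eq. Qed.

Let isolated_l1_b2 k : 0 < k ->
  isolated (hypoplactic_congruence n) (l1 :: nseq k b2).
Proof.
move=> k0 y /hypoplacticP[B bB zy]; set z := _ :: _ in zy *.
have nz i : ~ inversion i z.
  apply: no_inversion; rewrite /z /= !has_nseq !plusE !minusE k0 /=.
  by case: i => [[|[|i]] hi].
have cy i := counts_of_eq (nz i) (bisim_eps bB i zy) (bisim_phi bB i zy).
(* A barred letter j' makes epsilon of index j positive, an unbarred j makes phi of index j
   positive. In [z] only epsilon of index 2 and phi of index 1 are positive. *)
have yl a : a \in y -> (a == l1) || (a == b2).
  case: a => j [] ay.
    have : has (minus_letter j) z.
      have [_ e _] := cy j; rewrite has_count -e -has_count.
      by apply/hasP; exists (j, true) => //; rewrite minusE /=.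
    rewrite /z /= has_nseq !minusE k0 /= => /eqP e.
    by apply/orP; right; apply/eqP; congr pair; apply/val_inj; rewrite /= -e.
  have : has (plus_letter j) z.
    have [_ _ e] := cy j; rewrite has_count -e -has_count.
    by apply/hasP; exists (j, false) => //; rewrite plusE /=.
  rewrite /z /= has_nseq !plusE k0 /= => e.
  apply/orP; left; apply/eqP; congr pair; apply/val_inj => /=.
  by case/orP: e => /eqP; [move=> <-|case].
(* Phi of index 1 counts both 1 and 2', hence gives the length; epsilon of index 2 then counts the
   2' alone. *)
have sy : size y = k.+1.
  have [_ _] := cy i1; rewrite /z /= count_nseq !plusE /= mul1n add1n => <-.
  apply/esym/eqP; rewrite -all_count; apply/allP => a.
  by move=> /yl/orP[]/eqP->; rewrite plusE.
have my : count (minus_letter i2) y = k.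
  by have [_ -> _] := cy i2; rewrite /z /= count_nseq !minusE /= mul1n.
case: y zy cy yl sy my => // a y zy cy yl [sy].
have := yl a (mem_head _ _) => /orP[]/eqP ea; rewrite {a}ea in zy cy yl *.
  rewrite /= minusE /= add0n => my; rewrite /z; congr (_ :: _).
  rewrite -sy; apply/esym/all_pred1P.
  move/eqP: my; rewrite -{1}sy -all_count => /allP my; apply/allP => a ay.
  have := my a ay; have := yl a; rewrite inE ay orbT => /(_ isT)/orP[]/eqP-> //.
  by rewrite minusE.
(* Here [y] starts with 2'. The operator f of index 1 turns [z] into 2 (2')^k, which has a
   2-inversion, but only changes the first 2' of [y] into 1', leaving no letter 2 or 3'. *)
move=> _; have [ny _ _] := cy i1.
have := bisim_f bB i1 zy; rewrite !qf_Some //= ?plusE //=.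
rewrite /f_letter /= next1 -/l2 -/b1 => /(bisim_eps bB i2).
have /inversion_qeps -> : inversion i2 (l2 :: nseq k b2).
  exists [::], l2, [::], b2, (nseq k.-1 b2); split; rewrite ?plusE ?minusE //.
  by rewrite -{1}(prednK k0).
move/esym/inversion_qeps/inversion_has/andP => [/hasP[a]].
rewrite inE => /orP[/eqP->|ay]; rewrite plusE //=.
by have := yl a; rewrite inE ay orbT => /(_ isT)/orP[]/eqP->.
Qed.

Let isolated_b2_l3 k : 0 < k ->
  isolated (hypoplactic_congruence n) (rcons (nseq k b2) l3).
Proof.
move=> k0 y /hypoplacticP[B bB zy]; set z := rcons _ _ in zy *.
have nz i : ~ inversion i z.
  apply: no_inversion; rewrite /z !has_rcons !has_nseq !plusE !minusE k0 /=.
  by case: i => [[|[|[|i]]] hi].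
have cy i := counts_of_eq (nz i) (bisim_eps bB i zy) (bisim_phi bB i zy).
have cz p : count p z = p b2 * k + p l3.
  by rewrite /z -cats1 count_cat count_nseq /= addn0.
(* Phi of index 1 is positive because of 2', so it cannot exclude the letter 1. Since epsilon of
   index 1 vanishes, 1' is absent, and the first weight coordinate then excludes 1. *)
have l1y : l1 \notin y.
  have b1y : b1 \notin y.
    apply/negP => b1y; have [_ e _] := cy i1.
    have : has (minus_letter i1) y by apply/hasP; exists b1; rewrite ?minusE.
    by rewrite has_count e cz !minusE.
  have := congr1 (fun f : {ffun 'I_n -> int} => f i1) (bisim_wt bB zy).
  rewrite !ffunE !cz /= -/l1 -/b1 (count_memPn b1y) !GRing.subr0.
  by move=> [e]; apply/count_memPn.
have yl a : a \in y -> (a == l3) || (a == b2).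
  case: a => j [] ay.
    have : has (minus_letter j) z.
      have [_ e _] := cy j; rewrite has_count -e -has_count.
      by apply/hasP; exists (j, true) => //; rewrite minusE /=.
    rewrite /z has_rcons has_nseq !minusE k0 /= => e.
    apply/orP; right; apply/eqP; congr pair; apply/val_inj => /=.
    by case/orP: e => /eqP; [case|move=> <-].
  have : has (plus_letter j) z.
    have [_ _ e] := cy j; rewrite has_count -e -has_count.
    by apply/hasP; exists (j, false) => //; rewrite plusE /=.
  rewrite /z has_rcons has_nseq !plusE k0 /= => /orP[/eqP e|/eqP[e]].
    by apply/orP; left; apply/eqP; congr pair; apply/val_inj; rewrite /= -e.
  by case/negP: l1y; rewrite (_ : l1 = (j, false)) //; congr pair; apply/val_inj.
have sy : size y = k.+1.
  have [_] := cy i2; rewrite cz !minusE /= mul1n addn1 => <- _.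
  apply/esym/eqP; rewrite -all_count; apply/allP => a.
  by move=> /yl/orP[]/eqP->; rewrite minusE.
have my : count (plus_letter i1) y = k.
  by have [_ _ ->] := cy i1; rewrite cz !plusE /= mul1n addn0.
case/lastP: y zy {l1y} cy yl sy my => // y a zy cy yl; rewrite size_rcons => -[sy].
have := yl a; rewrite mem_rcons mem_head => /(_ isT)/orP[]/eqP ea;
    rewrite {a}ea in zy cy yl *.
  rewrite -cats1 count_cat /= !addn0 => my; rewrite /z -cats1; congr (_ ++ _).
  rewrite -sy; apply/esym/all_pred1P.
  move/eqP: my; rewrite -{1}sy -all_count => /allP my; apply/allP => a ay.
  have := my a ay; have := yl a; rewrite mem_rcons inE ay orbT.
  by move=> /(_ isT)/orP[]/eqP->.
(* Here [y] ends with 2'. The operator e of index 2 turns [z] into (2')^k 2, which has a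
   1-inversion, and turns the last letter of [y] into 3', leaving no letter 2 or 1'. *)
move=> _; have [ny _ _] := cy i2.
have := bisim_e bB i2 zy; rewrite !qe_Some ?has_rcons ?minusE //=.
rewrite /replace_last !rev_rcons /= !minusE /= !rev_cons !revK.
rewrite /e_letter /= next2 -/l2 -/b3 => /(bisim_eps bB i1).
have /inversion_qeps -> : inversion i1 (rcons (nseq k b2) l2).
  exists [::], b2, (nseq k.-1 b2), l2, [::]; split; rewrite ?plusE ?minusE //.
  by rewrite -{1}(prednK k0) /= cats1.
move/esym/inversion_qeps/inversion_has/andP => [_ /hasP[a]].
rewrite mem_rcons inE => /orP[/eqP->|ay]; rewrite minusE //=.
by have := yl a; rewrite mem_rcons inE ay orbT => /(_ isT)/orP[]/eqP->.
Qed.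

Let isolated_l2_b2 k : 0 < k ->
  isolated (hypoplactic_congruence n) (l2 :: nseq k b2).
Proof.
move=> k0; apply: (isolated_qe (i := i1) _ _ (isolated_l1_b2 k0)).
  rewrite qe_Some /= ?minusE //.
    rewrite -cat1s replace_last_cat has_nseq ?minusE ?andbF.
    by rewrite /replace_last /= ?minusE.
  rewrite -cat1s => /inversion_cat[||[]].
  - by apply: no_inversion; rewrite /= ?plusE.
  - by apply: no_inversion; rewrite !has_nseq !minusE ?andbF.
  - by rewrite /= ?plusE.
rewrite qf_Some /= ?plusE //= ?/f_letter /= ?next1 //.
by apply: no_inversion; rewrite /= !has_nseq !minusE ?andbF.
Qed.

Let isolated_b2_l2 k : 0 < k ->
  isolated (hypoplactic_congruence n) (rcons (nseq k b2) l2).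
Proof.
move=> k0; apply: (isolated_qf (i := i2) _ _ (isolated_b2_l3 k0)).
  rewrite qf_Some ?has_rcons ?plusE // -cats1.
    rewrite replace_first_cat has_nseq plusE andbF /= ?plusE /f_letter /=.
    by rewrite next2 cats1.
  move=> /inversion_cat[||[_]].
  - by apply: no_inversion; rewrite !has_nseq !plusE ?andbF.
  - by apply: no_inversion; rewrite /= ?minusE ?andbF.
  - by rewrite /= ?minusE.
rewrite qe_Some ?has_rcons ?minusE //.
  by rewrite /replace_last rev_rcons /= ?minusE rev_cons revK.
by apply: no_inversion; rewrite !has_rcons !has_nseq !plusE ?andbF.
Qed.

(** * The congruent pair and the conclusion *)

Let block_word k : word n := l2 :: rcons (nseq k b2) l2.
Let swapped_word k : word n := b2 :: l2 :: rcons (nseq k b2) l2.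

(** Two barred letters are the minimum: one moves to the front, and one must stay after the first 2
    to keep the 2-inversion. *)
Lemma block_word_hypoplactic k : hypoplactic (block_word k.+2) (swapped_word k.+1).
Proof.
have perm : perm_eq (block_word k.+2) (swapped_word k.+1).
  by rewrite /block_word /swapped_word /= (perm_catCA [:: l2] [:: b2]).
have inv1 : inversion i1 (block_word k.+2) /\ inversion i1 (swapped_word k.+1).
  split; [exists [:: l2], b2, (nseq k.+1 b2), l2, [::]
         |exists [::], b2, [::], l2, (rcons (nseq k.+1 b2) l2)].
    by split; rewrite ?plusE ?minusE // /block_word /= cats1.
  by split; rewrite ?plusE ?minusE.
have inv2 : inversion i2 (block_word k.+2) /\ inversion i2 (swapped_word k.+1).
  split; [exists [::], l2, [::], b2, (rcons (nseq k.+1 b2) l2)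
         |exists [:: b2], l2, [::], b2, (rcons (nseq k b2) l2)].
    by split; rewrite ?plusE ?minusE.
  by split; rewrite ?plusE ?minusE.
apply: hypoplactic_singleton => [|i].
  by apply/ffunP => i; rewrite !ffunE !(permP perm).
have [e|ne] := boolP ((i == i1) || (i == i2)).
  have [/inversion_qeps eu /inversion_qeps ev] :
      inversion i (block_word k.+2) /\ inversion i (swapped_word k.+1).
    by case/orP: e => /eqP ->.
  have qphiN w : qeps i w = None -> qphi i w = None.
    by rewrite /qeps /qphi; case: asboolP.
  by rewrite /qe /qf !(qphiN _ eu) !(qphiN _ ev) eu ev.
(* The letters 2 and 2' concern only the indices 1 and 2, stored as 0 and 1. *)
have pm a : a \in block_word k.+2 ->
    (plus_letter i a = false) * (minus_letter i a = false).
  have : (i != 0 :> nat) && (i != 1 :> nat) by rewrite negb_or in ne.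
  rewrite /block_word inE mem_rcons inE mem_nseq => ne' /or3P[]/eqP->;
    by rewrite plusE minusE /=; case: (nat_of_ord i) ne' => [|[]].
have pm' a : a \in swapped_word k.+1 ->
    (plus_letter i a = false) * (minus_letter i a = false).
  by rewrite -(perm_mem perm); apply: pm.
have zero w : (forall a, a \in w ->
      (plus_letter i a = false) * (minus_letter i a = false)) ->
    qeps i w = Some 0 /\ qphi i w = Some 0.
  move=> H; have h0 : ~~ has (plus_letter i) w by apply/hasPn => a /H ->.
  have h1 : ~~ has (minus_letter i) w by apply/hasPn => a /H ->.
  have nw : ~ inversion i w by apply: no_inversion; rewrite negb_and h0.
  rewrite qeps_Some ?qphi_Some //.
  by move: h0 h1; rewrite !has_count -!eqn0Ngt => /eqP-> /eqP->.
have [eu pu] := zero _ pm; have [ev pv] := zero _ pm'.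
by rewrite /qe /qf eu ev pu pv.
Qed.

Lemma hypoplactic_not_finitely_generated :
  ~ finitely_generated_congruence (hypoplactic_congruence n).
Proof.
apply: not_finitely_generated => N.
exists (block_word N.+2), (swapped_word N.+1); split.
- exact: block_word_hypoplactic.
- by case=> /eqP; rewrite /l2.
- rewrite /block_word -cats1; apply: (locally_isolated_block (p := [:: l2])).
  + exact: leqW.
  + exact: isolated_l2_b2.
  + by rewrite cats1; apply: isolated_b2_l2.
Qed.

End Family.

Theorem theorem9p39 (n : nat) (n_ge3 : 3 <= n) :
  ~ finitely_generated_congruence (hypoplactic_congruence n) /\
  ~ finitely_presented (hypo n).
Proof.
have nfg := hypoplactic_not_finitely_generated n_ge3.
by split=> // /finitely_presented_congruence.
Qed.
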